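(* Assume hypothesis (H). Then $$\sum_{N>0}\dim_{\mathbb Q}\ker C_{N,3}\, x^N\;\ge\; 2\,\mathbb O(x)\,\mathbb S(x),$$ where $\ge$ between power series means coefficientwise inequality.
   Context: For integers $N,r\ge1$ let $S_{N,r}=\{(n_1,\dots,n_r)\in\mathbb Z^r:\ n_1+\dots+n_r=N,\ \text{each } n_i\ge3 \text{ odd}\}$; when used as an index set it is ordered lexicographically decreasingly. For $m=(m_1,\dots,m_r)$ and $n=(n_1,\dots,n_r)$ let $\delta\binom{m}{n}=1$ if $m_i=n_i$ for all $i$, and $0$ otherwise. $\mathbf V_{N,r}$ is the $\mathbb Q$-span of the monomials $x_1^{n_1-1}\cdots x_r^{n_r-1}$ with $(n_1,\dots,n_r)\in S_{N,r}$. $\mathsf{Vect}_{N,r}=\mathbb Q^{S_{N,r}}$ (row vectors), and $\pi:\mathbf V_{N,r}\to\mathsf{Vect}_{N,r}$ is the isomorphism sending $\sum a_{n_1,\dots,n_r}x_1^{n_1-1}\cdots x_r^{n_r-1}$ to $(a_{n_1,\dots,n_r})_{(n_1,\dots,n_r)\in S_{N,r}}$. For $r\ge2$, $\mathbf W_{N,r}=\{P\in\mathbf V_{N,r}: P(x_1,\dots,x_r)=P(x_2-x_1,x_2,x_3,\dots,x_r)-P(x_2-x_1,x_1,x_3,\dots,x_r)\}$. Ihara action: for $f\in\mathbb Q[t]$ and a polynomial $g$ in $r-1$ variables, $(f\mathbin{\underline\circ}g)(x_1,\dots,x_r)=f(x_1)g(x_2,\dots,x_r)+\sum_{i=1}^{r-1}\big(f(x_{i+1}-x_i)g(x_1,\dots,\widehat{x_{i+1}},\dots,x_r)-(-1)^{\deg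 f}f(x_i-x_{i+1})g(x_1,\dots,\widehat{x_i},\dots,x_r)\big)$ (hats denote omitted variables). For positive integers $m_i,n_i$, $e\binom{m_1,\dots,m_r}{n_1,\dots,n_r}$ is the coefficient of $x_1^{n_1-1}\cdots x_r^{n_r-1}$ in $t^{m_1-1}\mathbin{\underline\circ}\,(y_1^{m_2-1}\cdots y_{r-1}^{m_r-1})$. $E_{N,r}$ is the $S_{N,r}\times S_{N,r}$ matrix with $(m,n)$-entry $e\binom{m}{n}$. For $2\le j\le r$, $E^{(j)}_{N,r}$ is the $S_{N,r}\times S_{N,r}$ matrix with $(m,n)$-entry $\delta\binom{m_1,\dots,m_{r-j}}{n_1,\dots,n_{r-j}}\,e\binom{m_{r-j+1},\dots,m_r}{n_{r-j+1},\dots,n_r}$ (so $E^{(r)}_{N,r}=E_{N,r}$). $C_{N,r}=E^{(2)}_{N,r}E^{(3)}_{N,r}\cdots E^{(r-1)}_{N,r}E_{N,r}$ (so $C_{N,2}=E_{N,2}$), and $F_{N,r}=E_{N,r}-\mathrm{id}$. For a matrix $A$, $\ker A$ denotes its right kernel (column vectors $v$ with $Av=0$). $\mathbb O(x)=\frac{x^3}{1-x^2}$, $\mathbb S(x)=\frac{x^{12}}{(1-x^4)(1-x^6)}$. It is known (Tasaka) that for $r\ge2$ and $P\in\mathbf W_{N,r}$, $\pi(P)F_{N,r}$ lies in the left kernel $\{v: vE_{N,r}=0\}$. Hypothesis (H): for all $N$ and all $r\ge2$ the linear map $\mathbf W_{N,r}\to\{v\in\mathsf{Vect}_{N,r}: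 vE_{N,r}=0\}$, $P\mapsto\pi(P)F_{N,r}$, is injective. *)

(* Defs.v *)
From HB Require Import structures.
From mathcomp Require Import all_boot all_order all_algebra.
Unset Printing Implicit Defensive.
Import Order.TTheory GRing.Theory Num.Theory.
Local Open Scope ring_scope.

(* ---------- Multivariate polynomials over Q in r variables ----------------
   mpoly r = Q[x_1,...,x_r], built as iterated univariate polynomials:
   mpoly (r+1) = (mpoly r)[x_{r+1}].  Variables are indexed from 0:
   var r k is x_{k+1}. *)
Fixpoint mpoly (r : nat) : comNzRingType :=
  match r with
  | 0 => rat
  | r'.+1 => {poly (mpoly r')}
  end.

(* x_{k+1} in Q[x_1..x_r] (0 if k >= r) *)
Fixpoint var (r k : nat) : mpoly r :=
  match r return mpoly r with
  | 0 => 0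
  | r'.+1 => if k == r' then ('X : {poly mpoly r'}) else ((@var r' k)%:P : {poly mpoly r'})
  end.

Fixpoint cst (r : nat) (c : rat) : mpoly r :=
  match r return mpoly r with
  | 0 => c
  | r'.+1 => ((@cst r' c)%:P : {poly mpoly r'})
  end.

Fixpoint coefm (r : nat) : seq nat -> mpoly r -> rat :=
  match r return seq nat -> mpoly r -> rat with
  | 0 => fun _ p => p
  | r'.+1 => fun es (p : {poly mpoly r'}) => @coefm r' es (nth 0 (polyseq p) (nth 0%N es r'))
  end.

Definition fev (r : nat) (f : {poly rat}) (y : mpoly r) : mpoly r :=
  \sum_(k < size f) cst r f`_k * y ^+ k.

Definition mono (r : nat) (zs : nat -> mpoly r) (es : seq nat) : mpoly r :=
  \prod_(k < size es) zs k ^+ nth 0%N es k.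

(* ---------- Ihara action, for g = y_1^{ms_0}...y_{r-1}^{ms_{r-2}} ----------
   (f o g)(x_1..x_r) = f(x_1) g(x_2..x_r)
     + sum_{i=1}^{r-1} ( f(x_{i+1}-x_i) g(x_1,..,^x_{i+1},..,x_r)
                         - (-1)^{deg f} f(x_i-x_{i+1}) g(x_1,..,^x_i,..,x_r) ).
   In 0-based indices, omitting variable k means  j |-> x_(bump k j). *)
Definition ihara (r : nat) (f : {poly rat}) (ms : seq nat) : mpoly r :=
  let X := var r in
  fev r f (X 0%N) * mono r (fun j => X j.+1) ms
  + \sum_(i < r.-1)
      ( fev r f (X i.+1 - X i) * mono r (fun j => X (bump i.+1 j)) ms
        - (-1) ^+ (size f).-1 * fev r f (X i - X i.+1) * mono r (fun j => X (bump i j)) ms ).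

Definition ecoef (m n : seq nat) : rat :=
  coefm (size m) (map predn n)
        (ihara (size m) ('X^((head 0%N m).-1) : {poly rat}) (map predn (behead m))).

Definition inS (N r : nat) (s : seq nat) : bool :=
  [&& size s == r, sumn s == N & all (fun a => odd a && (3 <= a)%N) s].

Fixpoint tuples (r N : nat) : seq (seq nat) :=
  match r with
  | 0 => [:: [::]]
  | r'.+1 => [seq a :: s | a <- iota 0 N.+1, s <- tuples r' N]
  end.

Fixpoint lexge (u v : seq nat) : bool :=
  match u, v with
  | a :: u', b :: v' => (b < a)%N || ((a == b) && lexge u' v')
  | _, _ => true
  end.

Definition Sset (N r : nat) : seq (seq nat) :=
  sort lexge [seq s <- tuples r N | inS N r s].

Definition dS (N r : nat) : nat := size (Sset N r).

Definition idx (N r : nat) (i : 'I_(dS N r)) : seq nat := nth [::] (Sset N r) i.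

Definition Emx (N r : nat) : 'M[rat]_(dS N r) :=
  \matrix_(i, j) ecoef (idx N r i) (idx N r j).

Definition Ejmx (N r j : nat) : 'M[rat]_(dS N r) :=
  \matrix_(i, k)
    ((take (r - j) (idx N r i) == take (r - j) (idx N r k))%:R
     * ecoef (drop (r - j) (idx N r i)) (drop (r - j) (idx N r k))).

Definition Cmx (N r : nat) : 'M[rat]_(dS N r) :=
  foldr (fun j A => Ejmx N r j *m A) (Emx N r) (iota 2 (r - 2)).

Definition Fmx (N r : nat) : 'M[rat]_(dS N r) := Emx N r - 1%:M.

(* dim_Q of the right kernel {v : C v = 0} = left kernel of C^T *)
Definition dimker (N r : nat) : nat := \rank (kermx (Cmx N r)^T).

Definition Pev (N r : nat) (v : 'rV[rat]_(dS N r)) (zs : nat -> mpoly r) : mpoly r :=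
  \sum_(i < dS N r) cst r (v 0 i) * mono r zs (map predn (idx N r i)).

Definition inW (N r : nat) (v : 'rV[rat]_(dS N r)) : Prop :=
  let X := var r in
  Pev N r v X =
    Pev N r v (fun k => if k == 0%N then X 1%N - X 0%N else X k)
  - Pev N r v (fun k => if k == 0%N then X 1%N - X 0%N
                    else if k == 1%N then X 0%N else X k).

Definition hypH : Prop :=
  forall (N r : nat), (2 <= r)%N ->
  forall v : 'rV[rat]_(dS N r), inW N r v -> v *m Fmx N r = 0 -> v = 0.

Definition series := nat -> rat.
Definition smul (a b : series) : series :=
  fun n => \sum_(k < n.+1) a k * b (n - k)%N.
Definition xpow (k : nat) : series := fun n => (n == k)%:R.
(* 1/(1 - x^k) = sum_{j>=0} x^{kj}, for k > 0 *)
Definition geom (k : nat) : series := fun n => (k %| n)%:R.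

Definition Oser : series := smul (xpow 3) (geom 2).
Definition Sser : series := smul (xpow 12) (smul (geom 4) (geom 6)).

(* Main.v *)
Require Import Defs.
From HB Require Import structures.
From mathcomp Require Import all_boot all_order all_algebra.
From mathcomp Require Import zify ring lra.
Import Order.TTheory GRing.Theory Num.Theory.
Local Open Scope ring_scope.
Set Implicit Arguments.
Unset Strict Implicit.

(* Write C = E2 * E3, with E2 = E^(2)_{N,3} and E3 = E_{N,3}.  Two families of
   rows lie in the left kernel of C.
   - If every slice of u at fixed x_1 lies in W_{.,2}, the relation defining W
     says exactly that u E2 = 0.
   - If P is in W_{N,3}, the defining relation and the antisymmetry of P in
     x_1, x_2 give pi(P) F = - pi(P) E2, and pi(P) E2 E3 = 0.  For the latter,
     only the monomials of pi(P) E2 with even positive exponents are kept before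
     E3 is applied: odd exponents are removed by averaging over x_2 -> -x_2, and
     monomials with a zero exponent do not contribute to coefficients with
     positive exponents.  What remains cancels by the three-term relation and
     sign changes of x_2.
   A row in both families is killed by F and lies in W_{N,3}, so it vanishes by
   (H).  Both families have the dimension of the sum over odd n >= 3 of
   W_{N-n,2}.  To bound dim W_{k,2} from below, put w = k - 2.  Even antisymmetric
   polynomials f without x^w have floor(k/4) - 1 coefficients, and
   g(a,b) = f(a,b) + f(b,a-b) + f(a-b,a) vanishes as soon as floor(w/6)
   coefficients of the odd polynomial q(t) = g(1+t,1-t) vanish: if t^m divides q
   then so do (1+t)^m and (1-t)^m, by the cyclic symmetry of g, and q has degree
   < w and vanishes at 1/3 and -1/3. *)

(** * Even period polynomials in one variable *)

Section Homogenization.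
Variables (R : comNzRingType) (iota : {rmorphism rat -> R}).

(** This is B^w p(A/B), with the coefficients of [p] beyond degree [w] dropped. It carries
    identities in one variable to binary forms over any target of [iota]. *)
Definition hom (w : nat) (p : {poly rat}) (A B : R) : R :=
  \sum_(i < w.+1) iota p`_i * A ^+ i * B ^+ (w - i).

Lemma hom_sum (I : Type) (s : seq I) (c : I -> rat) (p : I -> {poly rat}) w A B :
  hom w (\sum_(i <- s) c i *: p i) A B = \sum_(i <- s) iota (c i) * hom w (p i) A B.
Proof.
rewrite /hom; under [RHS]eq_bigr => i _ do rewrite mulr_sumr.
rewrite exchange_big; apply: eq_bigr => j _.
rewrite coef_sum rmorph_sum !mulr_suml; apply: eq_bigr => i _.
by rewrite coefZ rmorphM !mulrA.
Qed.

Lemma homB w p q A B : hom w (p - q) A B = hom w p A B - hom w q A B.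
Proof.
by rewrite /hom -sumrB; apply: eq_bigr => i _; rewrite coefB rmorphB !mulrBl.
Qed.

Lemma homD w p q A B : hom w (p + q) A B = hom w p A B + hom w q A B.
Proof.
by rewrite /hom -big_split; apply: eq_bigr => i _; rewrite coefD rmorphD !mulrDl.
Qed.

Lemma hom_mul_lin w (p : {poly rat}) (s t : rat) A B : (size p <= w.+1)%N ->
  hom w.+1 ((s%:P + t *: 'X) * p) A B = (iota s * B + iota t * A) * hom w p A B.
Proof.
move=> sp; rewrite /hom mulrDl.
rewrite (eq_bigr (fun i : 'I_w.+2 => iota s * (iota p`_i * A ^+ i * B ^+ (w.+1 - i)) +
  iota t * (iota (if (i : nat) == 0%N then 0 else p`_i.-1) * A ^+ i * B ^+ (w.+1 - i)))); last first.
  by move=> i _; rewrite coefD coefCM -scalerAl coefZ coefXM rmorphD !rmorphM; ring.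
rewrite big_split -!mulr_sumr /= mulrDl -!mulrA; congr (_ * _ + _ * _).
  rewrite big_ord_recr /= (nth_default _ sp) rmorph0 !mul0r addr0 mulr_sumr.
  apply: eq_bigr => i _; rewrite subSn; last by rewrite -ltnS.
  by rewrite exprS mulrCA.
rewrite big_ord_recl /= rmorph0 !mul0r add0r mulr_sumr.
by apply: eq_bigr => i _; rewrite /bump /= !add1n subSS exprS -!mulrA mulrCA.
Qed.

Lemma size_lin_exp (s t : rat) i : (size ((s%:P + t *: 'X) ^+ i) <= i.+1)%N.
Proof.
apply: leq_trans (size_poly_exp_leq _ _) _; rewrite ltnS.
rewrite -[leqRHS]mul1n leq_mul2r; apply/orP; right.
rewrite -subn1 leq_subLR; apply: leq_trans (size_polyD _ _) _.
rewrite geq_max (leq_trans (size_polyC_leq1 _)) //.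
by apply: leq_trans (size_scale_leq _ _) _; rewrite size_polyX.
Qed.

Lemma hom_lin (s t s' t' : rat) i j A B :
  hom (i + j) ((s%:P + t *: 'X) ^+ i * (s'%:P + t' *: 'X) ^+ j) A B =
  (iota s * B + iota t * A) ^+ i * (iota s' * B + iota t' * A) ^+ j.
Proof.
elim: i => [|i IH].
  rewrite !expr0 !mul1r add0n; elim: j => [|j IH].
    by rewrite /hom big_ord1 !expr0 coef1 rmorph1 !mulr1.
  by rewrite !exprS hom_mul_lin ?IH // size_lin_exp.
rewrite addSn !exprS -!mulrA hom_mul_lin ?IH //.
apply: leq_trans (size_polyMleq _ _) _.
rewrite -subn1 leq_subLR; apply: leq_trans (leq_add (size_lin_exp s t i) (size_lin_exp s' t' j)) _.
by rewrite addnS !addSn.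
Qed.

(** Every surviving term contains A^k. Thus vanishing to order [k] at 0 becomes divisibility by the
    k-th power of any [A] for which [q] is a form in [A], [B]. *)
Lemma hom_dvd w k (p : {poly rat}) A B : (forall i, (i < k)%N -> p`_i = 0) ->
  exists q, hom w p A B = A ^+ k * q.
Proof.
move=> p0; exists (\sum_(i < w.+1) iota p`_i * A ^+ (i - k) * B ^+ (w - i)).
rewrite mulr_sumr; apply: eq_bigr => i _.
have [lik|lki] := ltnP i k; first by rewrite p0 // rmorph0 !mul0r mulr0.
have -> : A ^+ i = A ^+ k * A ^+ (i - k) by rewrite -exprD subnKC.
by rewrite -!mulrA mulrCA.
Qed.

Definition alt (al be : nat) (a b : R) : R := a ^+ al * b ^+ be - a ^+ be * b ^+ al.

(** For even exponents this is the sum of [alt] over the orbit (a,b), (b,b-a), (b-a,-a) of a map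
    whose cube is -1. *)
Definition cyc (al be : nat) (a b : R) : R :=
  alt al be a b + alt al be b (a - b) + alt al be (a - b) a.

End Homogenization.

Lemma expN_even (R : pzRingType) (x : R) k : ~~ odd k -> (- x) ^+ k = x ^+ k.
Proof. by move=> ek; rewrite exprNn -signr_odd (negbTE ek) mul1r. Qed.

Lemma alt_rmorph (R S : comNzRingType) (f : {rmorphism R -> S}) al be a b :
  f (alt al be a b) = alt al be (f a) (f b).
Proof. by rewrite /alt !(rmorphB, rmorphM, rmorphXn). Qed.

Lemma cyc_rmorph (R S : comNzRingType) (f : {rmorphism R -> S}) al be a b :
  f (cyc al be a b) = cyc al be (f a) (f b).
Proof. by rewrite /cyc 2!rmorphD !alt_rmorph rmorphB. Qed.

Section Alt.
Variables (R : comNzRingType) (al be : nat).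
Hypotheses (eal : ~~ odd al) (ebe : ~~ odd be).
Implicit Types a b : R.

Lemma altC a b : alt al be b a = - alt al be a b.
Proof. by rewrite /alt; ring. Qed.

Lemma altNl a b : alt al be (- a) b = alt al be a b.
Proof. by rewrite /alt !expN_even. Qed.

Lemma altNr a b : alt al be a (- b) = alt al be a b.
Proof. by rewrite /alt !expN_even. Qed.

Lemma cycC a b : cyc al be b a = - cyc al be a b.
Proof.
rewrite /cyc -(opprB a b) altNl altNr.
by rewrite (altC a b) (altC (a - b) a) (altC b (a - b)); ring.
Qed.

Lemma cyc_rot a b : cyc al be b (b - a) = cyc al be a b.
Proof.
rewrite /cyc (_ : b - (b - a) = a); last by ring.
by rewrite -(opprB a b) altNl altNr; ring.
Qed.

Lemma cyc_flip a b : cyc al be a (a - b) = - cyc al be a b.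
Proof. by rewrite cyc_rot cycC. Qed.

Lemma cycZ (s a b : R) : cyc al be (s * a) (s * b) = s ^+ (al + be) * cyc al be a b.
Proof. by rewrite /cyc /alt -!mulrBr !exprMn exprD; ring. Qed.

End Alt.

(** On the line a = 1+t, b = 1-t the exchange of [a] and [b] is t -> -t, so antisymmetry becomes
    oddness. *)
Definition cycp (al be : nat) : {poly rat} := cyc al be (1 + 'X) (1 - 'X).

Lemma hom_alt_lin (R : comNzRingType) (iota : {rmorphism rat -> R}) al be
    (s t s' t' : rat) A B :
  hom iota (al + be) (alt al be (s%:P + t *: 'X) (s'%:P + t' *: 'X)) A B =
  alt al be (iota s * B + iota t * A) (iota s' * B + iota t' * A).
Proof. by rewrite /alt homB hom_lin [in X in _ - X]addnC hom_lin. Qed.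

Lemma hom_cycp (R : comNzRingType) (iota : {rmorphism rat -> R}) al be A B :
  hom iota (al + be) (cycp al be) A B = cyc al be (B + A) (B - A).
Proof.
have ea : 1 + 'X = 1%:P + 1 *: 'X :> {poly rat} by rewrite scale1r.
have eb : 1 - 'X = 1%:P + (- 1) *: 'X :> {poly rat} by rewrite scaleN1r.
have ec : 1 + 'X - (1 - 'X) = 0%:P + 2 *: 'X :> {poly rat}.
  by rewrite scaler_nat polyC0; ring.
rewrite /cycp /cyc ec ea eb 2!homD !hom_alt_lin !(rmorphN, rmorph0, rmorph1, rmorph_nat).
by congr (alt _ _ _ _ + alt _ _ _ _ + alt _ _ _ _); ring.
Qed.

Lemma coef_comp_scaleX (R : comNzRingType) (p : {poly R}) (c : R) j :
  (p \Po (c *: 'X))`_j = c ^+ j * p`_j.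
Proof.
elim/poly_ind: p j => [|p a IH] j; first by rewrite comp_poly0 coef0 mulr0.
rewrite comp_poly_MXaddC !coefD -scalerAr coefZ !coefMX !coefC.
by case: j => [|j] /=; rewrite ?IH ?expr0 ?exprS; ring.
Qed.

(** Powers of linear factors with distinct roots are coprime. *)
Lemma dvdp_prod_XsubC (F : fieldType) (q : {poly F}) (s : seq (F * nat)) :
  uniq (map fst s) -> {in s, forall x, ('X - x.1%:P) ^+ x.2 %| q} ->
  \prod_(x <- s) ('X - x.1%:P) ^+ x.2 %| q.
Proof.
elim: s => [|x s IH] /=; first by rewrite big_nil dvd1p.
case/andP=> xs us sq; rewrite big_cons Gauss_dvdp.
  rewrite sq ?mem_head // IH // => y ys.
  by apply: sq; rewrite inE ys orbT.
rewrite coprimep_expl // big_seq; apply: (big_ind (coprimep _)).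
- exact: coprimep1.
- by move=> a b ca cb; rewrite coprimepMr ca.
move=> y ys; apply: coprimep_expr; rewrite coprimep_XsubC root_XsubC.
by apply: contraNneq xs => e; apply/mapP; exists y.
Qed.

Lemma size_prod_XsubC_exp (F : fieldType) (s : seq (F * nat)) :
  size (\prod_(x <- s) ('X - x.1%:P) ^+ x.2) = (\sum_(x <- s) x.2).+1.
Proof.
elim: s => [|x s IH]; first by rewrite !big_nil size_poly1.
rewrite !big_cons size_monicM ?monic_exp ?monicXsubC //.
  by rewrite size_exp_XsubC IH addnS addSn.
by rewrite -size_poly_gt0 IH.
Qed.

(** * Cyclic sums determined by their low coefficients *)

Section Vanishing.
Variables (w d : nat) (al : 'I_d -> nat) (c : 'I_d -> rat).
Hypotheses (ew : ~~ odd w) (eal : forall i, ~~ odd (al i)) (lal : forall i, (al i <= w)%N).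

Let be i := (w - al i)%N.
Let ebe i : ~~ odd (be i).
Proof. by rewrite /be oddB // (negbTE ew) (negbTE (eal i)). Qed.
Let albe i : (al i + be i = w)%N.
Proof. by rewrite subnKC. Qed.

Let q := \sum_i c i *: cycp (al i) (be i).

Let homq (R : comNzRingType) (iota : {rmorphism rat -> R}) A B :
  hom iota w q A B = \sum_i iota (c i) * cyc (al i) (be i) (B + A) (B - A).
Proof.
by rewrite hom_sum; apply: eq_bigr => i _; rewrite -{1}(albe i) hom_cycp.
Qed.

Let q_odd : q \Po (- 'X) = - q.
Proof.
rewrite /q raddf_sum -sumrN; apply: eq_bigr => i _.
rewrite /= linearZ /= -scalerN; congr (_ *: _).
rewrite /cycp -cycC // /cyc /alt !(rmorphB, rmorphD, rmorphM, rmorphXn, rmorph1) /= !comp_polyX.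
by rewrite opprK.
Qed.

Let q_even j : ~~ odd j -> q`_j = 0.
Proof.
move=> ej; have := congr1 (fun p : {poly rat} => p`_j) q_odd.
rewrite -scaleN1r coef_comp_scaleX coefN -signr_odd (negbTE ej) mul1r => e.
lra.
Qed.

Let q_hom : q = hom polyC w q 'X 1.
Proof. by rewrite homq /q; apply: eq_bigr => i _; rewrite mul_polyC. Qed.

Let size_q : (size q <= w)%N.
Proof.
(* The coefficient of index [w] vanishes because [w] is even. *)
apply/leq_sizeP => j; rewrite leq_eqVlt => /orP[/eqP <-|wj]; first exact: q_even.
rewrite q_hom /hom coef_sum big1 // => i _.
rewrite expr1n mulr1 coefCM coefXn gtn_eqF ?mulr0 //.
exact: leq_ltn_trans (leq_ord i) wj.
Qed.

Hypothesis q_low : forall l, (l < w %/ 6)%N -> q`_l.*2.+1 = 0.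

(** Even coefficients vanish by parity and the first [w %/ 6] odd ones by [q_low], so this is a
    lower bound for the order of [q] at 0. *)
Let k := (w %/ 6).*2.+1.

Let q_lt j : (j < k)%N -> q`_j = 0.
Proof.
rewrite /k => jk; have [oj|ej] := boolP (odd j); last exact: q_even.
rewrite -(odd_double_half j) oj add1n; apply: q_low.
by move: jk; rewrite -{1}(odd_double_half j) oj add1n ltnS ltn_double.
Qed.

Let dvd_lin (A B : {poly rat}) (u : rat) : u != 0 -> u *: q = hom polyC w q A B -> A ^+ k %| q.
Proof.
move=> u0 e; rewrite -(dvdpZr _ _ u0) e.
by have [r ->] := hom_dvd polyC w A B q_lt; apply: dvdp_mulr.
Qed.

Let dvd_1DX : (1 + 'X) ^+ k %| q.
Proof.
(* With a = 1+X and b = 1-X, this choice of [A], [B] gives B+A = 2b and B-A = 2(b-a), twice the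
   rotated pair of [cyc_rot]. *)
apply: (@dvd_lin (1 + 'X) (1 - 3 * 'X) (2 ^+ w)); first by rewrite expf_neq0.
rewrite homq /q scaler_sumr; apply: eq_bigr => i _.
rewrite /cycp -cyc_rot // mul_polyC scalerA mulrC -scalerA; congr (_ *: _).
have e2 : 2%:P = 2 :> {poly rat} by rewrite rmorph_nat.
rewrite -mul_polyC rmorphXn /= e2 -{1}(albe i) -cycZ.
by congr cyc; ring.
Qed.

Let dvd_1BX : (1 - 'X) ^+ k %| q.
Proof.
have /dvdpP [r e] := dvd_1DX; rewrite -[q]opprK -q_odd dvdpNr e.
by rewrite rmorphM rmorphXn rmorphD rmorph1 /= comp_polyX dvdp_mull.
Qed.

Let root_third : root q 3^-1.
Proof.
rewrite /root /q horner_sum big1 // => i _; rewrite hornerZ.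
suff -> : (cycp (al i) (be i)).[3^-1] = 0 by rewrite mulr0.
(* At t = 1/3 the pair is (4/3, 2/3), proportional to (2,1), which (a,b) -> (a,a-b) fixes; that map
   changes the sign of [cyc]. *)
have -> : (cycp (al i) (be i)).[3^-1] = cyc (al i) (be i) (2 / 3 * 2) (2 / 3 * 1).
  rewrite -horner_evalE cyc_rmorph !(rmorphB, rmorphD) rmorph1 /= horner_evalE hornerX.
  by congr cyc; lra.
rewrite cycZ; have := cyc_flip (eal i) (ebe i) 2 (1 : rat).
rewrite (_ : 2 - 1 = 1) // => e.
by have -> : cyc (al i) (be i) 2 1 = 0 :> rat; [lra|rewrite mulr0].
Qed.

Lemma cycp_comb_eq0 : q = 0.
Proof.
apply/eqP; apply: contraT => q0.
pose s := [:: (0, k); (1, k); (-1, k); (3^-1, 1%N); (- 3^-1, 1%N)] : seq (rat * nat).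
have sq : {in s, forall x, ('X - x.1%:P) ^+ x.2 %| q}.
  move=> x; rewrite !inE => /or4P[/eqP->|/eqP->|/eqP->|/orP[/eqP->|/eqP->]] /=.
  - rewrite subr0; apply: (@dvd_lin _ 1 1); first exact: oner_neq0.
    by rewrite scale1r.
  - by rewrite -opprB exprNn -signr_odd /= odd_double expr1 mulN1r dvdpNl.
  - by rewrite rmorphN opprK addrC.
  - by rewrite dvdp_XsubCl.
  - rewrite dvdp_XsubCl /root -[q]opprK -q_odd hornerN horner_comp hornerN hornerX opprK oppr_eq0.
    exact: root_third.
have := dvdp_leq q0 (dvdp_prod_XsubC (s := s) _ sq).
rewrite size_prod_XsubC_exp !big_cons big_nil /= => /(_ isT) le1.
(* The product has size 3k+3 = 6 floor(w/6) + 6 > w, while [q] has size at most [w]. *)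
have := leq_trans le1 size_q; have := ltn_ceil w (isT : (0 < 6)%N); rewrite /k; lia.
Qed.

Theorem alt_comb_relation (R : comNzRingType) (iota : {rmorphism rat -> R}) (a b : R) :
  \sum_i iota (c i) * cyc (al i) (be i) a b = 0.
Proof.
have e2 : iota (2^-1) * 2 = 1.
  by rewrite -(rmorph_nat iota 2) -rmorphM mulVf ?rmorph1.
(* Here A = (a-b)/2 and B = (a+b)/2, so that B+A = a and B-A = b. *)
have := homq iota (iota 2^-1 * (a - b)) (iota 2^-1 * (a + b)).
rewrite cycp_comb_eq0 /hom big1 => [|i _]; last by rewrite coef0 rmorph0 !mul0r.
move=> {2}->; apply: eq_bigr => i _; congr (_ * cyc _ _ _ _).
  by rewrite -[LHS]mul1r -e2; ring.
by rewrite -[LHS]mul1r -e2; ring.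
Qed.
End Vanishing.

(** * Coefficients in iterated polynomial rings *)

Lemma cst_zmod r : zmod_morphism (cst r).
Proof. by elim: r => [|r IH] a b //=; rewrite IH rmorphB. Qed.

Lemma cst_monoid r : monoid_morphism (cst r).
Proof.
elim: r => [|r [IH1 IHM]] //=; split; first by rewrite IH1.
by move=> a b; rewrite IHM rmorphM.
Qed.

HB.instance Definition _ r := GRing.isZmodMorphism.Build rat (mpoly r) (cst r) (@cst_zmod r).
HB.instance Definition _ r := GRing.isMonoidMorphism.Build rat (mpoly r) (cst r) (@cst_monoid r).

Lemma coefm_zmod r es : zmod_morphism (coefm r es).
Proof. by elim: r es => [|r IH] es p q //=; rewrite coefB IH. Qed.

HB.instance Definition _ r es :=
  GRing.isZmodMorphism.Build (mpoly r) rat (coefm r es) (@coefm_zmod r es).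

Lemma coefm_cstM r es c p : coefm r es (cst r c * p) = c * coefm r es p.
Proof. by elim: r es p => [|r IH] es p //=; rewrite coefCM IH. Qed.

(** Substitution of [l k] times the variable for each variable. Values 0 test independence of a
    variable; values -1 change signs. *)
Fixpoint scale r (l : nat -> rat) : {rmorphism mpoly r -> mpoly r} :=
  match r return {rmorphism mpoly r -> mpoly r} with
  | 0 => idfun
  | r'.+1 => (comp_poly (cst r' (l r') *: 'X) \o map_poly (scale r' l)
               : {poly mpoly r'} -> {poly mpoly r'})
  end.

Lemma coefm_scale r l es p :
  coefm r es (scale r l p) = (\prod_(k < r) l k ^+ nth 0%N es k) * coefm r es p.
Proof.
elim: r es p => [|r IH] es p /=; first by rewrite big_ord0 mul1r.
rewrite coef_comp_scaleX coef_map -rmorphXn coefm_cstM IH big_ord_recr /=; ring.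
Qed.

Lemma scale_cst r l c : scale r l (cst r c) = cst r c.
Proof. by elim: r => [|r IH] //=; rewrite map_polyC /= IH comp_polyC. Qed.

Lemma scale_var r l k : scale r l (var r k) = cst r (l k) * var r k.
Proof.
elim: r => [|r IH] /=; first by rewrite mulr0.
case: eqP => [->|_]; first by rewrite map_polyX comp_polyX mul_polyC.
by rewrite map_polyC /= IH comp_polyC rmorphM.
Qed.

Local Arguments var : simpl never.

(** * The Ihara action written out for two and three variables *)

Lemma fev_Xn r k y : fev r 'X^k y = y ^+ k.
Proof.
rewrite /fev size_polyXn big_ord_recr /= big1 ?add0r => [|i _].
  by rewrite coefXn eqxx rmorph1 mul1r.
by rewrite coefXn ltn_eqF ?rmorph0 ?mul0r.
Qed.

Lemma mono2 r zs i j : mono r zs [:: i; j] = zs 0%N ^+ i * zs 1%N ^+ j.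
Proof. by rewrite /mono !big_ord_recl big_ord0 /= mulr1. Qed.

Lemma mono3 r zs i j k :
  mono r zs [:: i; j; k] = zs 0%N ^+ i * zs 1%N ^+ j * zs 2%N ^+ k.
Proof. by rewrite /mono !big_ord_recl big_ord0 /= mulr1 mulrA. Qed.

(* The actions of E_{N,3} ([Phi]) and E^(2)_{N,3} ([Psi]) on polynomial functions. *)
Definition Phi (R : comNzRingType) (x y z : R) (q : R -> R -> R -> R) : R :=
  q x y z + q (y - x) x z - q (y - x) y z + q (z - y) x y - q (z - y) x z.

Definition monf (R : comNzRingType) (i j k : nat) (a b c : R) : R := a ^+ i * b ^+ j * c ^+ k.

(** For even [i] the factor (-1)^deg is 1 and x_i - x_{i+1} may be replaced by x_{i+1} - x_i. *)
Lemma ihara3 i j k : ~~ odd i ->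
  ihara 3 'X^i [:: j; k] = Phi (var 3 0) (var 3 1) (var 3 2) (@monf (mpoly 3) i j k).
Proof.
move=> ei; rewrite /ihara size_polyXn !fev_Xn /= -signr_odd (negbTE ei) expr0.
rewrite !big_ord_recl big_ord0 !fev_Xn !mono2 /bump /= ?addn0 ?add1n /Phi /monf.
move: (var 3 0) (var 3 1) (var 3 2) => x y z.
by rewrite -(opprB y x) -(opprB z y) !expN_even //; ring.
Qed.

Lemma ihara2 i j : ~~ odd i ->
  let x := var 2 0 in let y := var 2 1 in
  ihara 2 'X^i [:: j] = x ^+ i * y ^+ j + (y - x) ^+ i * x ^+ j - (y - x) ^+ i * y ^+ j.
Proof.
move=> ei x y; rewrite /ihara size_polyXn !fev_Xn /= -signr_odd (negbTE ei) expr0.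
rewrite !big_ord_recl big_ord0 !fev_Xn /mono !big_ord_recl !big_ord0 /bump /= ?addn0 ?add1n.
move: @x @y => /=; move: (var 2 0) (var 2 1) => x y.
by rewrite -(opprB y x) !expN_even //; ring.
Qed.

Lemma coefm_monf e0 e1 e2 i j k :
  coefm 3 [:: e0; e1; e2] (@monf (mpoly 3) i j k (var 3 0) (var 3 1) (var 3 2)) =
  ([:: i; j; k] == [:: e0; e1; e2])%:R.
Proof.
rewrite /monf /var /= -!rmorphXn /= -rmorphM /= coefCM coefXn mulr_natr coefMn.
rewrite coefCM coefXn mulr_natr !coefMn coefXn !eqseq_cons eqxx andbT.
by rewrite [e0 == i]eq_sym [e1 == j]eq_sym [e2 == k]eq_sym; do 3!case: (_ == _).
Qed.

(** Renames x_1, x_2 to x_2, x_3. Multiplying the result by a power of x_1 accounts for the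
    Kronecker delta in E^(2). *)
Definition shift2 : {rmorphism mpoly 2 -> mpoly 3} :=
  (map_poly (map_poly (@polyC rat)) : {poly {poly rat}} -> {poly {poly {poly rat}}}).

Lemma coefm_shift2 e0 e1 e2 i (q : mpoly 2) :
  coefm 3 [:: e0; e1; e2] (var 3 0 ^+ i * shift2 q) = (i == e0)%:R * coefm 2 [:: e1; e2] q.
Proof.
rewrite /var /= -!rmorphXn /= coefCM coef_map /= coefCM coef_map /= coefMC coefXn eq_sym.
by [].
Qed.

Lemma shift2_var0 : shift2 (var 2 0) = var 3 1.
Proof. by rewrite /var /= map_polyC /= map_polyX. Qed.

Lemma shift2_var1 : shift2 (var 2 1) = var 3 2.
Proof. by rewrite /var /= map_polyX. Qed.

(** * The action of E on rows *)

Lemma mem_tuples r N s : (s \in tuples r N) = (size s == r) && all (fun a => a <= N)%N s.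
Proof.
elim: r s => [|r IH] s; first by rewrite inE; case: s.
change (tuples r.+1 N) with [seq a :: u | a <- iota 0 N.+1, u <- tuples r N].
apply/allpairsPdep/idP => [[a [u [ha hu ->]]]|].
  move: ha hu; rewrite mem_iota add0n ltnS IH /= eqSS => -> /andP[-> ->].
  by [].
case: s => [|a u] //= /andP[su /andP[ha hu]]; exists a, u; split => //.
  by rewrite -/(iota 0 N.+1) mem_iota add0n ltnS.
by rewrite IH -eqSS su.
Qed.

Lemma uniq_tuples r N : uniq (tuples r N).
Proof.
elim: r => [|r IH] //; apply: allpairs_uniq => //; first exact: iota_uniq.
by move=> [a u] [b v] _ _ /= [-> ->].
Qed.

Lemma leq_sumn (s : seq nat) a : a \in s -> (a <= sumn s)%N.
Proof.
elim: s => [|b s IH] //=; rewrite inE => /orP[/eqP->|/IH h]; first exact: leq_addr.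
exact: leq_trans h (leq_addl _ _).
Qed.

Lemma mem_Sset N r s : (s \in Sset N r) = inS N r s.
Proof.
rewrite mem_sort mem_filter mem_tuples andbC /inS.
case: eqP => //= _; case: eqP => [<-|]; last by rewrite andbF.
by have -> : all (fun a => a <= sumn s)%N s by apply/allP => a; apply: leq_sumn.
Qed.

Lemma uniq_Sset N r : uniq (Sset N r).
Proof. by rewrite sort_uniq filter_uniq // uniq_tuples. Qed.

Lemma idx_inj N r : injective (@idx N r).
Proof.
move=> i j /eqP; rewrite /idx nth_uniq ?uniq_Sset // => /eqP.
exact: val_inj.
Qed.

Lemma idx_inS N r (i : 'I_(dS N r)) : inS N r (idx N r i).
Proof. by rewrite -mem_Sset mem_nth. Qed.

Lemma inS_idx N r s : inS N r s -> exists i : 'I_(dS N r), idx N r i = s.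
Proof.
rewrite -mem_Sset => sS; have lt : (index s (Sset N r) < dS N r)%N by rewrite index_mem.
by exists (Ordinal lt); rewrite /idx /= nth_index.
Qed.

(** In terms of the exponents n_i - 1, being odd and at least 3 means being even and positive. *)
Lemma inS3P N s : inS N 3 s ->
  exists i j k : nat, [/\ s = [:: i.+1; j.+1; k.+1], ~~ odd i, ~~ odd j & ~~ odd k] /\
    [/\ (0 < i)%N, (0 < j)%N, (0 < k)%N & (i + j + k + 3 = N)%N].
Proof.
case: s => [|[|i] [|[|j] [|[|k] [|l s]]]] //=; rewrite /inS /= ?andbF //.
move=> /andP[/eqP e]; rewrite !ltnS => /and4P[/andP[oi li] /andP[oj lj] /andP[ok lk] _].
by exists i, j, k; repeat split => //; lia.
Qed.

Lemma inS3 N i j k : (i + j + k + 3 = N)%N -> inS N 3 [:: i.+1; j.+1; k.+1] =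
  [&& ~~ odd i, ~~ odd j, ~~ odd k, (0 < i)%N, (0 < j)%N & (0 < k)%N].
Proof.
move=> e; rewrite /inS /= addn0 !ltnS (_ : (_ == N)%N = true); last by apply/eqP; lia.
have h m : ~~ odd m && (1 < m)%N = ~~ odd m && (0 < m)%N by case: m => [|[|m]].
by rewrite !h; do 3!case: (odd _) => //=; do 3!case: (0 < _)%N.
Qed.

Lemma inS_even N i j k : inS N 3 [:: i.+1; j.+1; k.+1] ->
  [/\ ~~ odd i, ~~ odd j & ~~ odd k].
Proof. by rewrite /inS /= => /and4P[_ /andP[-> _] /andP[-> _] /andP[/andP[-> _] _]]. Qed.

(** This row is zero when [s] is not in S_{N,3}. *)
Definition unit_row N s : 'rV[rat]_(dS N 3) := \row_j (idx N 3 j == s)%:R.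

Lemma unit_row_mul N s (A : 'M[rat]_(dS N 3)) j n : idx N 3 j = s ->
  (unit_row N s *m A) 0 n = A j n.
Proof.
move=> js; have -> : unit_row N s = delta_mx 0 j.
  by apply/rowP => i; rewrite !mxE eqxx -js (inj_eq (@idx_inj N 3)).
by rewrite -rowE mxE.
Qed.

Definition cf N (n : 'I_(dS N 3)) (p : mpoly 3) : rat := coefm 3 (map predn (idx N 3 n)) p.

HB.instance Definition _ N n :=
  GRing.isZmodMorphism.Build (mpoly 3) rat (@cf N n) (@coefm_zmod 3 _).

Lemma cfZ N n c p : @cf N n (cst 3 c * p) = c * @cf N n p.
Proof. exact: coefm_cstM. Qed.

Definition Psi (R : comNzRingType) (x y z : R) (q : R -> R -> R -> R) : R :=
  q x y z + q x (z - y) y - q x (z - y) z.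

Notation x0 := (var 3 0). Notation x1 := (var 3 1). Notation x2 := (var 3 2).

Lemma cf_monf N n i j k : @cf N n (@monf (mpoly 3) i j k x0 x1 x2) =
  (idx N 3 n == [:: i.+1; j.+1; k.+1])%:R.
Proof.
rewrite /cf; have [a [b [c [[-> _ _ _] _]]]] := inS3P (idx_inS n).
by rewrite [map _ _]/= coefm_monf eq_sym.
Qed.

Lemma unit_row_E N i j k n : inS N 3 [:: i.+1; j.+1; k.+1] ->
  (unit_row N [:: i.+1; j.+1; k.+1] *m Emx N 3) 0 n =
  cf n (Phi x0 x1 x2 (@monf (mpoly 3) i j k)).
Proof.
move=> sS; have [m ms] := inS_idx sS; rewrite (unit_row_mul _ _ ms) mxE ms /ecoef [size _]/= [head _ _]/= [map _ (behead _)]/= ihara3 //.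
by have [] := inS_even sS.
Qed.

Lemma unit_row_E2 N i j k n : inS N 3 [:: i.+1; j.+1; k.+1] ->
  (unit_row N [:: i.+1; j.+1; k.+1] *m Ejmx N 3 2) 0 n =
  cf n (Psi x0 x1 x2 (@monf (mpoly 3) i j k)).
Proof.
move=> sS; have [m ms] := inS_idx sS; rewrite (unit_row_mul _ _ ms) mxE ms /cf.
have ej : ~~ odd j by have [] := inS_even sS.
have [a [b [c [[-> _ _ _] _]]]] := inS3P (idx_inS n).
change (3 - 2)%N with 1%N; rewrite /ecoef; cbn [take drop size map behead predn head].
rewrite ihara2 // eqseq_cons andbT eqSS -coefm_shift2 /Psi /monf.
rewrite !(rmorphB, rmorphD, rmorphM, rmorphXn) shift2_var0 shift2_var1; congr coefm.
by move: x0 x1 x2 => x y z; ring.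
Qed.

(* The half-sum over b -> -b; h plays the role of 1/2. *)
Definition Av (R : comNzRingType) (h : R) (q : R -> R -> R -> R) (a b c : R) : R :=
  h * (q a b c + q a (- b) c).

Definition half : mpoly 3 := cst 3 2^-1.

(* [averages N q]: applying E to the row of coefficients of q with indices in
   S_{N,3} amounts to letting E act on the b-even part of the whole q. *)
Definition averages N (q : mpoly 3 -> mpoly 3 -> mpoly 3 -> mpoly 3) :=
  forall n, \sum_m @cf N m (q x0 x1 x2) * Emx N 3 m n = cf n (Phi x0 x1 x2 (Av half q)).

Lemma Phi_sum (R : comNzRingType) (I : Type) (s : seq I) (c : I -> R) q (x y z : R) :
  Phi x y z (fun a b d => \sum_(i <- s) c i * q i a b d) = \sum_(i <- s) c i * Phi x y z (q i).
Proof.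
rewrite /Phi -!(big_split, sumrB); apply: eq_bigr => i _ /=; ring.
Qed.

Lemma Av_sum (R : comNzRingType) (I : Type) (s : seq I) (c : I -> R) h q (x y z : R) :
  Av h (fun a b d => \sum_(i <- s) c i * q i a b d) x y z = \sum_(i <- s) c i * Av h (q i) x y z.
Proof.
rewrite /Av -!big_split mulr_sumr; apply: eq_bigr => i _ /=; ring.
Qed.

Lemma Phi_ext (R : comNzRingType) (x y z : R) q q' :
  (forall a b c, q a b c = q' a b c) -> Phi x y z q = Phi x y z q'.
Proof. by move=> e; rewrite /Phi !e. Qed.

Lemma Av_monf_even (R : comNzRingType) (h : R) i j k a b c : h * 2 = 1 -> ~~ odd j ->
  Av h (monf i j k) a b c = monf i j k a b c.
Proof.
by move=> h2 ej; rewrite /Av /monf expN_even // -mulr2n -mulr_natl mulrA h2 mul1r.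
Qed.

Lemma Av_monf_odd (R : comNzRingType) (h : R) i j k a b c : odd j ->
  Av h (monf i j k) a b c = 0.
Proof.
by move=> oj; rewrite /Av /monf exprNn -signr_odd oj expr1 mulN1r mulrN mulNr subrr mulr0.
Qed.

Lemma sub_exp_expand (R : comNzRingType) (iota : {rmorphism rat -> R}) i j k l x y z :
  x ^+ i * (z - y) ^+ j * y ^+ k * z ^+ l =
  \sum_(a < j.+1) iota ((- 1) ^+ a *+ 'C(j, a)) * monf i (a + k) (j - a + l) x y z.
Proof.
rewrite exprBn mulr_sumr !mulr_suml; apply: eq_bigr => a _.
rewrite /monf rmorphMn rmorphXn rmorphN rmorph1 !exprD -[_ *+ _]mulr_natr -[_ *+ _ in RHS]mulr_natr.
move: ((-1) ^+ a) (x ^+ i) (z ^+ (j - a)) (y ^+ a) (y ^+ k) (z ^+ l) ('C(j, a)%:R).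
by move=> u1 u2 u3 u4 u5 u6 u7; ring.
Qed.

(** * Passing from truncated rows to whole polynomials *)

Section Averages.
Variable N : nat.
Implicit Types q : mpoly 3 -> mpoly 3 -> mpoly 3 -> mpoly 3.

Lemma averages_eq q q' : (forall a b c, q a b c = q' a b c) -> averages N q -> averages N q'.
Proof. by move=> e H n; rewrite -e H /Phi /Av !e. Qed.

Lemma averages_sum (I : Type) (s : seq I) (c : I -> rat) (q : I -> _) :
  (forall i, averages N (q i)) ->
  averages N (fun x y z => \sum_(i <- s) cst 3 (c i) * q i x y z).
Proof.
move=> H n.
transitivity (\sum_(i <- s) c i * cf n (Phi x0 x1 x2 (Av half (q i)))).
  under [RHS]eq_bigr => i _ do rewrite -H mulr_sumr.
  rewrite exchange_big; apply: eq_bigr => m _ /=.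
  rewrite raddf_sum mulr_suml; apply: eq_bigr => i _; rewrite /= cfZ; ring.
under eq_bigr => i _ do rewrite -cfZ.
by rewrite -raddf_sum -Phi_sum; congr cf; apply: Phi_ext => a b d; rewrite Av_sum.
Qed.

(** Indices in S_{N,3} have positive exponents, so a polynomial unchanged by setting x_{d+1} = 0 has
    no coefficient there. *)
Lemma cf_indep n d p : (d < 3)%N -> scale 3 (fun k => (k != d)%:R) p = p -> @cf N n p = 0.
Proof.
move=> d3 e; rewrite /cf -e coefm_scale (bigD1 (Ordinal d3)) //= eqxx expr0n.
have [a [b [c [[-> _ _ _] [a0 b0 c0 _]]]]] := inS3P (idx_inS n).
suff -> : (nth 0 (map predn [:: a.+1; b.+1; c.+1]) d == 0)%N = false by rewrite !mul0r.
by case: d d3 {e} => [|[|[|]]] //= _; apply/negbTE; rewrite -lt0n.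
Qed.

(** When an exponent is zero, terms of [Phi] cancel and each remaining piece misses one variable. *)
Lemma cf_Phi_monf0 n i j k : ~~ [&& (0 < i)%N, (0 < j)%N & (0 < k)%N] ->
  @cf N n (Phi x0 x1 x2 (@monf (mpoly 3) i j k)) = 0.
Proof.
have sc d e : (e < 3)%N -> (e == d) = false -> scale 3 (fun k => (k != d)%:R) (var 3 e) = var 3 e.
  by move=> e3 ed; rewrite scale_var ed rmorph1 mul1r.
rewrite !negb_and -!eqn0Ngt => /or3P[] /eqP ->.
- apply: (@cf_indep _ 2) => //.
  have -> : Phi x0 x1 x2 (@monf (mpoly 3) 0 j k) = x0 ^+ j * x1 ^+ k.
    by rewrite /Phi /monf; move: x0 x1 x2 => x y z; ring.
  by rewrite rmorphM !rmorphXn !sc.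
- have -> : Phi x0 x1 x2 (@monf (mpoly 3) i 0 k) =
      x0 ^+ i * x2 ^+ k + ((x2 - x1) ^+ i * x1 ^+ k - (x2 - x1) ^+ i * x2 ^+ k).
    by rewrite /Phi /monf; move: x0 x1 x2 => x y z; ring.
  rewrite raddfD /= (@cf_indep _ 1) ?(@cf_indep _ 0) ?addr0 //.
    by rewrite rmorphB !rmorphM !rmorphXn rmorphB !sc.
  by rewrite rmorphM !rmorphXn !sc.
apply: (@cf_indep _ 2) => //.
have -> : Phi x0 x1 x2 (@monf (mpoly 3) i j 0) =
    x0 ^+ i * x1 ^+ j + (x1 - x0) ^+ i * x0 ^+ j - (x1 - x0) ^+ i * x1 ^+ j.
  by rewrite /Phi /monf; move: x0 x1 x2 => x y z; ring.
by rewrite rmorphB rmorphD !rmorphM !rmorphXn rmorphB !sc.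
Qed.

(** Either the monomial is indexed by S_{N,3}, or [j] is odd and the average is 0, or all exponents
    are even and one of them is 0. *)
Lemma averages_monf i j k : (i + j + k + 3 = N)%N -> ~~ odd i -> odd N ->
  averages N (@monf _ i j k).
Proof.
move=> e ei oN n.
under eq_bigr => m _ do rewrite cf_monf.
have Ave a b c : ~~ odd j -> Av half (@monf (mpoly 3) i j k) a b c = monf i j k a b c.
  by apply: Av_monf_even; rewrite /half -(rmorph_nat (cst 3) 2) -rmorphM mulVf ?rmorph1.
have [sS|sS] := boolP (inS N 3 [:: i.+1; j.+1; k.+1]).
  have [_ ej _] := inS_even sS.
  have [m ms] := inS_idx sS; have := unit_row_E n sS.
  rewrite (unit_row_mul _ _ ms) => em.
  rewrite (bigD1 m) //= big1 => [|m' mm']; last first.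
    by rewrite -ms (inj_eq (@idx_inj N 3)) (negbTE mm') mul0r.
  rewrite ms eqxx mul1r addr0 em; congr cf.
  by apply: Phi_ext => a b c; rewrite Ave.
rewrite big1 => [|m _]; last first.
  by case: eqP => [ms|_]; [rewrite -ms idx_inS in sS | rewrite mul0r].
have [oj|ej] := boolP (odd j).
  rewrite (@Phi_ext _ _ _ _ _ (fun _ _ _ => 0)).
    by rewrite /Phi !(subr0, addr0) raddf0.
  by move=> a b c; apply: Av_monf_odd.
(* The sum i + j + k is even because N is odd. *)
have ek : ~~ odd k by move: ei ej oN; rewrite -e !oddD; case: (odd i) (odd j) (odd k) => [] [] [].
rewrite (@Phi_ext _ _ _ _ _ (@monf _ i j k)) ?cf_Phi_monf0 //.
  by move: sS; rewrite inS3 // ei ej ek /=.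
by move=> a b c; rewrite Ave.
Qed.

(** The binomial expansion of (z-y)^j leaves the exponent of [x] and the total degree unchanged. *)
Lemma averages_sub_exp i j k l : (i + j + k + l + 3 = N)%N -> ~~ odd i -> odd N ->
  averages N (fun x y z => x ^+ i * (z - y) ^+ j * y ^+ k * z ^+ l).
Proof.
move=> e ei oN.
apply: averages_eq => [x y z|]; first by symmetry; apply: (sub_exp_expand (cst 3)).
apply: averages_sum => a; apply: averages_monf => //.
by have := ltn_ord a; lia.
Qed.

End Averages.

(** * Consequences of the period relation *)

Section PeriodRelations.
Variables (R : comNzRingType) (F : R -> R -> R -> R).
Hypotheses (FC : forall a b c, F b a c = - F a b c)
  (FNl : forall a b c, F (- a) b c = F a b c) (FNz : forall a b c, F a b (- c) = F a b c)
  (F3 : forall a b c, F a b c + F b (a - b) c + F (a - b) a c = 0).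

Let FNr a b c : F a (- b) c = F a b c.
Proof. by rewrite FC FNl -FC. Qed.

Lemma period_rel a b c : F a b c = F (b - a) b c - F (b - a) a c.
Proof.
have e := F3 a b c; rewrite -(opprB b a) FNr FNl in e.
by apply/eqP; rewrite -subr_eq0 -e [F b (b - a) c]FC; apply/eqP; ring.
Qed.

(** This is [period_rel] in the last two variables, with x_1 as a parameter. *)
Lemma Psi_rot x y z : Psi x y z (fun a b c => F b c a) = 0.
Proof. by rewrite /Psi [F y z x]period_rel; ring. Qed.

(** The terms of [Phi] in y-x sum to -F(x,y,z) by [period_rel]; antisymmetry turns those in z-y into
    the terms of -Psi. *)
Lemma Phi_Psi x y z : Phi x y z F - F x y z = - Psi x y z F.
Proof.
rewrite /Phi /Psi [F (z - y) x y]FC [F (z - y) x z]FC {1}[F x y z]period_rel; ring.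
Qed.

Variables (lam : {additive R -> rat}) (sg : {rmorphism R -> R}) (h x y z : R).
Hypotheses (lam_sg : forall p, lam (sg p) = lam p)
  (lamh : forall p, lam (h * p) = 2^-1 * lam p)
  (sgF : forall a b c, sg (F a b c) = F (sg a) (sg b) (sg c))
  (sgx : sg x = x) (sgy : sg y = - y) (sgz : sg z = z).

(** The functional [lam] will be a coefficient with even exponents, hence blind to y -> -y. The
    values of [lam] on the terms then satisfy linear relations that force the sum to vanish. *)
Lemma Phi_Av_Psi : lam (Phi x y z (Av h (fun a b c => Psi a b c F))) = 0.
Proof.
rewrite /Phi /Av /Psi !(raddfB, raddfD, lamh) /=.
have flip a b c : lam (F a b c) = lam (F (sg a) (sg b) (sg c)) by rewrite -sgF lam_sg.
have sgE := (rmorphB sg, rmorphD sg, sgx, sgy, sgz, FNz).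
have lam3 a b d c : d = a - b -> lam (F a b c) + lam (F b d c) + lam (F d a c) = 0.
  by move=> ->; rewrite -!raddfD F3 raddf0.
have lamC a b c : lam (F a b c) = - lam (F b a c) by rewrite -raddfN -FC.
rewrite !opprK !FNz !FNr.
have r0 : lam (F x y z) + lam (F (y - x) x z) - lam (F (y - x) y z) = 0.
  by rewrite [F x y z]period_rel raddfB; lra.
(* The relations [f1] to [f5] identify terms exchanged by y -> -y. *)
have f1 : lam (F x (z + y) y) = lam (F x (z - y) y) by rewrite flip !sgE.
have f2 : lam (F x (z + y) z) = lam (F x (z - y) z) by rewrite flip !sgE.
have f3 : lam (F (y - x) (z + x) x) = lam (F (y + x) (z + x) x).
  by rewrite flip !sgE -opprD FNl.
have f4 : lam (F (y - x) (z + y) y) = lam (F (y + x) (z - y) y).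
  by rewrite flip !sgE -opprD FNl.
have f5 : lam (F (z - y) (z + x) z) = lam (F (z + y) (z + x) z).
  by rewrite flip !sgE opprK.
have c1 := lamC x (z - y) y; have c2 := lamC x (z - y) z.
have c3 := lamC (y - x) (z - y) y; have c4 := lamC (y + x) (z - y) y.
(* The three-term relation is used on four pairs; the antisymmetry relations bring its terms to a
   common form. *)
have t1 : lam (F (z - x) (y - x) x) + lam (F (y - x) (z - y) x) + lam (F (z - y) (z - x) x) = 0.
  by apply: lam3; ring.
have t2 : lam (F (z + x) (y + x) x) + lam (F (y + x) (z - y) x) + lam (F (z - y) (z + x) x) = 0.
  by apply: lam3; ring.
have t3 : lam (F (z - x) (y - x) z) + lam (F (y - x) (z - y) z) + lam (F (z - y) (z - x) z) = 0.
  by apply: lam3; ring.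
have t4 : lam (F (z + y) (z + x) z) + lam (F (z + x) (y - x) z) + lam (F (y - x) (z + y) z) = 0.
  by apply: lam3; ring.
have c5 := lamC (z - x) (y - x) x; have c6 := lamC (y - x) (z - y) x.
have c7 := lamC (z + x) (y + x) x; have c8 := lamC (y + x) (z - y) x.
have c9 := lamC (z - x) (y - x) z; have c10 := lamC (z + x) (y - x) z.
lra.
Qed.
End PeriodRelations.

(** * Counting *)

Lemma smul_xpowl c b n : smul (xpow c) b n = if (c <= n)%N then b (n - c)%N else 0.
Proof.
rewrite /smul /xpow; case: leqP => [cn|nc].
  rewrite (bigD1 (Ordinal (cn : (c < n.+1)%N))) //= eqxx mul1r big1 ?addr0 // => i ic.
  by rewrite (_ : (i == c :> nat) = false) ?mul0r //; apply: negbTE.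
rewrite big1 // => i _; rewrite ltn_eqF ?mul0r //; exact: leq_trans (ltn_ord i) nc.
Qed.

(* [dimA k] counts the x^i y^j - x^j y^i with 0 < i < j even, i + j = k - 2;
   [dimR k] counts the linear conditions that put their combinations in W_{k,2}. *)
Definition dimA (k : nat) : nat := if odd k then 0%N else (k %/ 4).-1.
Definition dimR (k : nat) : nat := if odd k then 0%N else ((k - 2) %/ 6)%N.

(** Induction in steps of 12: for even [h], [dimA] grows by 3, [dimR] by 2 and the number of
    solutions of 4i + 6j = h by at most 1. For odd [h] all three are 0. *)
Lemma count46 h :
  (\sum_(0 <= k < h.+1) (4 %| k) * (6 %| h - k) + dimR (h + 12) <= dimA (h + 12))%N.
Proof.
elim/ltn_ind: h => h IH; have [h12|h12] := ltnP h 12.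
  clear IH; do 12![case: h h12 => [_|h h12]; first by rewrite unlock; vm_compute].
  by [].
have {IH} := IH (h - 12)%N; rewrite -(subnK h12) addnK; move: (h - 12)%N => {h12}h.
rewrite -[X in (X < _)%N]addn0 ltn_add2l => /(_ isT) IH.
(* The first [h.+1] terms repeat the sum for [h], since 6 divides 12; twelve new terms remain. *)
rewrite (big_cat_nat _ (n := h.+1)) //=; last by rewrite ltnS leq_addr.
rewrite (eq_big_nat _ _ (F2 := fun k => (4 %| k) * (6 %| h - k))%N); last first.
  by move=> k /andP[_ kh]; rewrite addnC -addnBA // dvdn_addr.
rewrite -[X in \sum_(X <= _ < (h + 12).+1) _]add0n big_addn subSS addKn.
move: (\sum_(0 <= k < h.+1) _)%N IH => G IH.
rewrite (eq_big_nat _ _ (F2 := fun i => (4 %| i + h.+1) * (6 %| 11 - i))%N); last first.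
  by move=> i _; have -> : (h + 12 - (i + h.+1) = 11 - i)%N by lia.
(* Only i = 5 and i = 11 make 11 - i divisible by 6, and 4 divides at most one of h + 6, h + 12,
   neither if [h] is odd. *)
have tail : (\sum_(0 <= i < 12) (4 %| i + h.+1) * (6 %| 11 - i) <= ~~ odd h)%N.
  rewrite unlock /= !(muln0, muln1, add0n, addn0) /dvdn.
  by have := odd_double_half h; case: odd; case: eqP; case: eqP => //=; lia.
set T := (X in (_ + X + _ <= _)%N); have {}tail : (T <= ~~ odd h)%N by exact: tail.
move: T IH tail => T; rewrite /dimR /dimA !oddD !addbF; case: (odd h) => /=; lia.
Qed.

Lemma geom46 h : smul (geom 4) (geom 6) h + (dimR (h + 12))%:R <= (dimA (h + 12))%:R.
Proof.
have -> : smul (geom 4) (geom 6) h = (\sum_(0 <= k < h.+1) (4 %| k) * (6 %| h - k))%N%:R.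
  by rewrite big_mkord natr_sum; apply: eq_bigr => k _; rewrite natrM.
by rewrite -natrD ler_nat count46.
Qed.

Lemma Sser_le k : Sser k + (dimR k)%:R <= (dimA k)%:R.
Proof.
rewrite /Sser smul_xpowl; case: ifP => k12.
  by have := geom46 (k - 12); rewrite subnK.
rewrite add0r ler_nat.
(* Below 12 the series S vanishes and only dimR k <= dimA k is left to compute. *)
by do 12?[case: k k12 => [_|k k12] //].
Qed.

(** The condition on [n] is the support of O, whose coefficients there are 1; [n] is the index of
    the slice variable. *)
Definition indep (N n : nat) : nat := if odd n && (2 < n)%N then dimA (N - n) else 0%N.
Definition rels (N n : nat) : nat := if odd n && (2 < n)%N then dimR (N - n) else 0%N.

Lemma OS_le N :
  smul Oser Sser N + (\sum_(n < N.+1) rels N n)%:R <= (\sum_(n < N.+1) indep N n)%:R.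
Proof.
rewrite /smul !natr_sum -big_split; apply: ler_sum => n _ /=.
rewrite /rels /indep /Oser smul_xpowl /geom.
case: ltnP => n3; last by rewrite andbF mul0r addr0.
rewrite dvdn2 oddB // addbT negbK; case: odd; last by rewrite mul0r addr0.
by rewrite mul1r Sser_le.
Qed.

(** * The two families in the left kernel of C *)

Lemma eqseq3S a b c a' b' c' : ([:: a.+1; b.+1; c.+1] == [:: a'.+1; b'.+1; c'.+1]) =
  [&& a == a', b == b' & c == c'].
Proof. by rewrite !eqseq_cons !eqSS andbT. Qed.

Lemma row_scaleE (R : pzSemiRingType) n k (u : 'rV[R]_n) j : (k *: u) 0 j = k * u 0 j.
Proof. by rewrite mxE. Qed.

Lemma row_subE (V : zmodType) n (u v : 'rV[V]_n) j : (u - v) 0 j = u 0 j - v 0 j.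
Proof. by rewrite !mxE. Qed.

Lemma PhiB (R : comNzRingType) (x y z : R) q q' :
  Phi x y z (fun a b c => q a b c - q' a b c) = Phi x y z q - Phi x y z q'.
Proof. by rewrite /Phi; ring. Qed.

Lemma PsiB (R : comNzRingType) (x y z : R) q q' :
  Psi x y z (fun a b c => q a b c - q' a b c) = Psi x y z q - Psi x y z q'.
Proof. by rewrite /Psi; ring. Qed.

Lemma Phi_Av_lin (R : comNzRingType) (x y z h k : R) q q' :
  Phi x y z (Av h q) + k * Phi x y z (Av h q') =
  Phi x y z (Av h (fun a b c => q a b c + k * q' a b c)).
Proof. by rewrite /Phi /Av; ring. Qed.

Lemma Psi_ext (R : comNzRingType) (x y z : R) q q' :
  (forall a b c, q a b c = q' a b c) -> Psi x y z q = Psi x y z q'.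
Proof. by move=> e; rewrite /Psi !e. Qed.

Lemma Psi_sum (R : comNzRingType) (I : Type) (s : seq I) (c : I -> R) q (x y z : R) :
  Psi x y z (fun a b d => \sum_(i <- s) c i * q i a b d) = \sum_(i <- s) c i * Psi x y z (q i).
Proof.
rewrite /Psi -!(big_split, sumrB); apply: eq_bigr => i _ /=; ring.
Qed.

(** * Parametrization of the slices *)

Section Families.
Variable N : nat.

(* (n, i) stands for the exponents 2i + 2 < N - n - 4 - 2i of the antisymmetric
   pair and n - 1 of the remaining variable. *)
Definition par := {n : 'I_N.+1 & 'I_(indep N n)}.
Definition con := {n : 'I_N.+1 & 'I_(rels N n)}.

Definition nu (t : par) : nat := (tag t).-1.
Definition al (t : par) : nat := (tagged t).*2.+2.
Definition be (t : par) : nat := (N - tag t - 2 - al t)%N.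

Lemma par_tag (t : par) :
  [&& odd (tag t), (2 < tag t)%N, ~~ odd (N - tag t) & ((tagged t).+2 <= (N - tag t) %/ 4)%N].
Proof.
case: t => n [i ii] /=; move: ii; rewrite /indep /dimA.
case: ifP => // /andP[-> ->]; case: ifP => //= _.
by case: (_ %/ 4)%N => [|[|k]].
Qed.

(** The bound i + 2 <= (N-n)/4 yields al < be, and N is odd because [n] is odd and N - n even. *)
Lemma parP (t : par) : [/\ ~~ odd (al t), ~~ odd (be t), ~~ odd (nu t) & odd N] /\
  [/\ (0 < al t)%N, (al t < be t)%N, (0 < nu t)%N & (al t + be t + nu t + 3 = N)%N].
Proof.
have /and4P[] := par_tag t; rewrite /be /al /nu; case: t => n i /=.
have := ltn_ord n; move: (nat_of_ord i) => {}i; move: (nat_of_ord n) => {}n nN on n3 eN iN.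
have eN' := odd_double_half (N - n); rewrite (negbTE eN) add0n in eN'.
have on' := odd_double_half n; rewrite on in on'.
move: ((N - n)./2) (n./2) eN' on' => h k eN' on'.
have -> : (N - n - 2 - i.*2.+2 = (h - i - 2).*2)%N by lia.
have -> : n.-1 = k.*2 by lia.
have -> : N = (h + k).*2.+1 by lia.
rewrite /= !odd_double; split; split => //; lia.
Qed.

Section Form.
Variables (R : comNzRingType) (iota : {rmorphism rat -> R}) (c : par -> rat).

Definition form (a b z : R) : R :=
  \sum_t iota (c t) * (alt (al t) (be t) a b * z ^+ nu t).

Lemma formC a b z : form b a z = - form a b z.
Proof. by rewrite /form -sumrN; apply: eq_bigr => t _; rewrite altC; ring. Qed.

Lemma formNl a b z : form (- a) b z = form a b z.
Proof. by apply: eq_bigr => t _; have [[? ? ? ?] _] := parP t; rewrite altNl. Qed.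

Lemma formNz a b z : form a b (- z) = form a b z.
Proof. by apply: eq_bigr => t _; have [[? ? ? ?] _] := parP t; rewrite expN_even. Qed.

Lemma form_rmorph (f : {rmorphism R -> R}) : (forall k, f (iota k) = iota k) ->
  forall a b z, f (form a b z) = form (f a) (f b) (f z).
Proof.
move=> fi a b z; rewrite rmorph_sum; apply: eq_bigr => t _.
by rewrite !rmorphM fi alt_rmorph rmorphXn.
Qed.

Hypothesis c_rel : forall s : con,
  \sum_(t : par | tag t == tag s) c t * (cycp (al t) (be t))`_(tagged s).*2.+1 = 0.

(** The relation holds slice by slice: pairs with equal tag share the power of [z], and
    [alt_comb_relation] applies to their sum. *)
Lemma form3 a b z : form a b z + form b (a - b) z + form (a - b) a z = 0.
Proof.
transitivity (\sum_t iota (c t) * (cyc (al t) (be t) a b * z ^+ nu t)).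
  by rewrite -!big_split; apply: eq_bigr => t _; rewrite /cyc /=; ring.
pose G (n : 'I_N.+1) (i : 'I_(indep N n)) := let t : par := Tagged _ i in
  iota (c t) * (cyc (al t) (be t) a b * z ^+ nu t).
transitivity (\sum_(n < N.+1) \sum_(i < indep N n) G n i).
  by rewrite sig_big_dep; apply: eq_bigr => -[].
apply: big1 => n _; case: (posnP (indep N n)) => [n0|npos].
  by apply: big1 => i _; exfalso; case: i => m; rewrite n0.
(* An inhabitant of the slice is what shows that [n] is odd and N - n even. *)
have /and4P[on n3 eN _] := par_tag (Tagged (fun n : 'I_N.+1 => 'I_(indep N n)) (Ordinal npos)).
rewrite /= in on n3 eN.
transitivity ((\sum_(i < indep N n) iota (c (Tagged _ i)) *
    cyc i.*2.+2 (N - n - 2 - i.*2.+2) a b) * z ^+ n.-1).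
  by rewrite mulr_suml; apply: eq_bigr => i _; rewrite /G /= mulrA.
rewrite (@alt_comb_relation (N - n - 2) _ (fun i : 'I_(indep N n) => i.*2.+2)) ?mul0r //.
- by move: eN; case: (N - n)%N => [|[|k]] //; rewrite !subSS subn0 /= negbK.
- by move=> i; rewrite /= odd_double.
- move=> i; have [_ [_ + _ _]] := parP (Tagged (fun n : 'I_N.+1 => 'I_(indep N n)) i).
  by rewrite /be /al /=; lia.
move=> l lw.
(* With w = N - n - 2, [dimR] counts exactly the floor(w/6) conditions required. *)
have lr : (l < rels N n)%N by rewrite /rels /dimR on n3 (negbTE eN).
have /= rel0 := c_rel (Tagged (fun n : 'I_N.+1 => 'I_(rels N n)) (Ordinal lr)).
rewrite -[RHS]rel0.
pose H (m : 'I_N.+1) (i : 'I_(indep N m)) := let t : par := Tagged _ i in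
  c t * (cycp (al t) (be t))`_l.*2.+1.
transitivity (\sum_(m < N.+1 | m == n) \sum_(i < indep N m) H m i).
  by rewrite big_pred1_eq coef_sum; apply: eq_bigr => i _; rewrite coefZ.
by rewrite sig_big_dep; apply: eq_big => [t|[]] //=; rewrite andbT.
Qed.

End Form.

(* The slice variable is x_3 in [slice_row] and x_1 in [slice_row']. *)
Definition slice_row (t : par) : 'rV[rat]_(dS N 3) :=
  unit_row N [:: (al t).+1; (be t).+1; (nu t).+1] - unit_row N [:: (be t).+1; (al t).+1; (nu t).+1].

Definition slice_row' (t : par) : 'rV[rat]_(dS N 3) :=
  unit_row N [:: (nu t).+1; (al t).+1; (be t).+1] - unit_row N [:: (nu t).+1; (be t).+1; (al t).+1].

Definition slice_mx : 'M[rat]_(#|{: par}|, dS N 3) := \matrix_(i < _) slice_row (enum_val i).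
Definition slice_mx' : 'M[rat]_(#|{: par}|, dS N 3) := \matrix_(i < _) slice_row' (enum_val i).
(** Its left kernel consists of coefficient vectors whose slices all satisfy the three-term
    relation. *)
Definition rel_mx : 'M[rat]_(#|{: par}|, #|{: con}|) :=
  \matrix_(i, j) let t : par := enum_val i in let s : con := enum_val j in
    if tag t == tag s then (cycp (al t) (be t))`_(tagged s).*2.+1 else 0.

Definition coefs (v : 'rV[rat]_#|{: par}|) (t : par) : rat := v 0 (enum_rank t).

Lemma sum_par (V : nmodType) (f : par -> V) :
  \sum_t f t = \sum_(i < #|{: par}|) f (enum_val i).
Proof.
rewrite (reindex (fun i : 'I_#|{: par}| => enum_val i : par)) //; exists enum_rank => x _; [exact: enum_valK|exact: enum_rankK].
Qed.

Lemma mul_slice_mx v : v *m slice_mx = \sum_t coefs v t *: slice_row t.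
Proof.
rewrite mulmx_sum_row sum_par; apply: eq_bigr => i _.
by rewrite rowK /coefs enum_valK.
Qed.

Lemma mul_slice_mx' v : v *m slice_mx' = \sum_t coefs v t *: slice_row' t.
Proof.
rewrite mulmx_sum_row sum_par; apply: eq_bigr => i _.
by rewrite rowK /coefs enum_valK.
Qed.

Lemma rel_mxP v : v *m rel_mx = 0 -> forall s : con,
  \sum_(t : par | tag t == tag s) coefs v t * (cycp (al t) (be t))`_(tagged s).*2.+1 = 0.
Proof.
move=> /rowP v0 s; have := v0 (enum_rank s); rewrite !mxE => e; rewrite -[RHS]e.
rewrite big_mkcond sum_par; apply: eq_bigr => i _.
by rewrite !mxE enum_rankK /coefs enum_valK; case: eqP; rewrite ?mulr0.
Qed.

Lemma par_inS t : [/\ inS N 3 [:: (al t).+1; (be t).+1; (nu t).+1],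
  inS N 3 [:: (be t).+1; (al t).+1; (nu t).+1],
  inS N 3 [:: (nu t).+1; (al t).+1; (be t).+1] &
  inS N 3 [:: (nu t).+1; (be t).+1; (al t).+1]].
Proof.
have [[ea eb en _] [a0 ab n0 e]] := parP t; have b0 := leq_ltn_trans (leq0n _) ab.
by split; rewrite inS3 ?ea ?eb ?en ?a0 ?b0 ?n0 //; rewrite -[RHS]e; lia.
Qed.

Definition slice (t : par) (a b z : mpoly 3) : mpoly 3 := alt (al t) (be t) a b * z ^+ nu t.

Lemma slice_monf t a b z :
  slice t a b z = monf (al t) (be t) (nu t) a b z - monf (be t) (al t) (nu t) a b z.
Proof. by rewrite /slice /alt /monf mulrBl. Qed.

Lemma slice_row_coef t n : slice_row t 0 n = cf n (slice t x0 x1 x2).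
Proof. by rewrite slice_monf raddfB /= !cf_monf !mxE. Qed.

Lemma slice_row_E t n : (slice_row t *m Emx N 3) 0 n = cf n (Phi x0 x1 x2 (slice t)).
Proof.
have [s1 s2 _ _] := par_inS t.
rewrite mulmxBl row_subE !unit_row_E // -raddfB; congr cf.
by rewrite -PhiB; apply: Phi_ext => a b c; rewrite slice_monf.
Qed.

Lemma slice_row_E2 t n : (slice_row t *m Ejmx N 3 2) 0 n = cf n (Psi x0 x1 x2 (slice t)).
Proof.
have [s1 s2 _ _] := par_inS t.
rewrite mulmxBl row_subE !unit_row_E2 // -raddfB; congr cf.
by rewrite -PsiB; apply: Psi_ext => a b c; rewrite slice_monf.
Qed.

Lemma slice_row'_E2 t n : (slice_row' t *m Ejmx N 3 2) 0 n =
  cf n (Psi x0 x1 x2 (fun a b c => slice t b c a)).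
Proof.
have [_ _ s1 s2] := par_inS t.
rewrite mulmxBl row_subE !unit_row_E2 // -raddfB; congr cf.
rewrite -PsiB; apply: Psi_ext => a b c; rewrite slice_monf /monf.
by rewrite ![_ * a ^+ _]mulrC !mulrA.
Qed.

Lemma averages_lin k q q' : averages N q -> averages N q' ->
  averages N (fun a b c => q a b c + cst 3 k * q' a b c).
Proof.
move=> Hq Hq' n.
under eq_bigr => m _ do rewrite raddfD /= cfZ mulrDl -mulrA.
by rewrite big_split /= -mulr_sumr Hq Hq' -cfZ -raddfD Phi_Av_lin.
Qed.

Lemma averages_sub q q' : averages N q -> averages N q' ->
  averages N (fun a b c => q a b c - q' a b c).
Proof.
move=> Hq Hq'; apply: (averages_eq _ (averages_lin (-1) Hq Hq')) => a b c.
by rewrite rmorphN1 mulN1r.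
Qed.

Lemma averages_add q q' : averages N q -> averages N q' ->
  averages N (fun a b c => q a b c + q' a b c).
Proof.
move=> Hq Hq'; apply: (averages_eq _ (averages_lin 1 Hq Hq')) => a b c.
by rewrite rmorph1 mul1r.
Qed.

(** Each term of [Psi] on a monomial is a product of powers of x, z-y, y and z, as in
    [averages_sub_exp]. *)
Lemma averages_Psi_monf i j k : (i + j + k + 3 = N)%N -> ~~ odd i -> odd N ->
  averages N (fun a b c => Psi a b c (@monf _ i j k)).
Proof.
move=> e ei oN; apply: averages_sub; [apply: averages_add|].
- exact: averages_monf.
- apply: (averages_eq _ (@averages_sub_exp N i j k 0 _ ei oN)) => [a b c|]; last by rewrite addn0.
  by rewrite expr0 mulr1.
apply: (averages_eq _ (@averages_sub_exp N i j 0 k _ ei oN)) => [a b c|]; last by rewrite addn0.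
by rewrite expr0 mulr1.
Qed.

Lemma averages_Psi_slice t : averages N (fun a b c => Psi a b c (slice t)).
Proof.
have [[ea eb en oN] [a0 ab n0 e]] := parP t.
apply: (averages_eq _ (averages_sub (@averages_Psi_monf (al t) (be t) (nu t) _ _ _)
  (@averages_Psi_monf (be t) (al t) (nu t) _ _ _))) => // [a b c|]; last by rewrite [X in (X + _ + _)%N]addnC.
by rewrite -PsiB; apply: Psi_ext => a' b' c'; rewrite slice_monf.
Qed.

Definition flip1 (k : nat) : rat := if k == 1%N then -1 else 1.

(** The exponent of x_2 is even at every index of S_{N,3}. *)
Lemma cf_flip n p : @cf N n (scale 3 flip1 p) = cf n p.
Proof.
have [a [b [d [[en ea eb ed] _]]]] := inS3P (idx_inS n).
rewrite /cf coefm_scale !big_ord_recl big_ord0 en /= !expr1n expN_even // expr1n.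
by rewrite !mul1r.
Qed.

Lemma PevB (w w' : 'rV[rat]_(dS N 3)) zs : Pev N 3 (w - w') zs = Pev N 3 w zs - Pev N 3 w' zs.
Proof.
by rewrite /Pev -sumrB; apply: eq_bigr => j _; rewrite row_subE rmorphB mulrBl.
Qed.

Lemma Pev_unit_row i j k zs : inS N 3 [:: i.+1; j.+1; k.+1] ->
  Pev N 3 (unit_row N [:: i.+1; j.+1; k.+1]) zs = monf i j k (zs 0%N) (zs 1%N) (zs 2%N).
Proof.
move=> /inS_idx [m ms]; rewrite /Pev (bigD1 m) //= big1 => [|m' mm'].
  by rewrite mxE ms eqxx rmorph1 mul1r addr0 mono3.
by rewrite mxE -ms (inj_eq (@idx_inj N 3)) (negbTE mm') rmorph0 mul0r.
Qed.

Lemma par_inj (t t' : par) : tag t = tag t' -> tagged t = tagged t' :> nat -> t = t'.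
Proof.
case: t t' => n i [n' i'] /= nn; subst n' => e.
by congr existT; apply: val_inj.
Qed.

Lemma par_neq (t t' : par) : al t = be t' -> be t = al t' -> False.
Proof.
have [_ [_ + _ _]] := parP t; have [_ [_ + _ _]] := parP t'; lia.
Qed.

Lemma par_eq (t t' : par) : (al t == al t') && (nu t == nu t') = (t == t').
Proof.
apply/andP/eqP => [[/eqP ea /eqP en]|-> //].
have /and4P[_ n3 _ _] := par_tag t; have /and4P[_ n3' _ _] := par_tag t'.
apply: par_inj; first by apply: val_inj; move: en n3 n3'; rewrite /nu /=; lia.
by move: ea; rewrite /al => -[] /double_inj.
Qed.

(** As al < be, the monomial with the smaller exponent first occurs in the row of [t] alone. This
    dual system makes the rows independent. *)
Lemma slice_row_dual t t' n : idx N 3 n = [:: (al t).+1; (be t).+1; (nu t).+1] ->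
  slice_row t' 0 n = (t == t')%:R.
Proof.
move=> e; rewrite row_subE !mxE e !eqseq3S.
have -> : (al t == be t') && ((be t == al t') && (nu t == nu t')) = false.
  by apply/negP => /and3P[/eqP ea /eqP eb _]; apply: par_neq ea eb.
rewrite subr0; have [->|ne] := eqVneq t t'; first by rewrite !eqxx.
by case: and3P => // -[ea _ en]; rewrite -par_eq ea en in ne.
Qed.

Lemma slice_row'_dual t t' n : idx N 3 n = [:: (nu t).+1; (al t).+1; (be t).+1] ->
  slice_row' t' 0 n = (t == t')%:R.
Proof.
move=> e; rewrite row_subE !mxE e !eqseq3S.
have -> : (nu t == nu t') && ((al t == be t') && (be t == al t')) = false.
  by apply/negP => /and3P[_ /eqP ea /eqP eb]; apply: par_neq ea eb.
rewrite subr0; have [->|ne] := eqVneq t t'; first by rewrite !eqxx.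
by case: and3P => // -[en ea _]; rewrite -par_eq ea en in ne.
Qed.

Lemma row_free_mulmx0 m p (A : 'M[rat]_(m, p)) : (forall v : 'rV_m, v *m A = 0 -> v = 0) -> row_free A.
Proof.
move=> H; rewrite -kermx_eq0; apply/rowV0P => v /sub_kermxP; exact: H.
Qed.

Lemma slice_mx_free : row_free slice_mx.
Proof.
apply: row_free_mulmx0 => v; rewrite mul_slice_mx => /rowP v0; apply/rowP => i.
have [/inS_idx [n en] _ _ _] := par_inS (enum_val i).
have := v0 n; rewrite summxE (bigD1 (enum_val i)) //= big1 => [|t ti].
  by rewrite row_scaleE (slice_row_dual _ en) eqxx mulr1 addr0 /coefs enum_valK => ->; rewrite !mxE.
by rewrite mxE (slice_row_dual _ en) eq_sym (negbTE ti) mulr0.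
Qed.

Lemma slice_mx'_free : row_free slice_mx'.
Proof.
apply: row_free_mulmx0 => v; rewrite mul_slice_mx' => /rowP v0; apply/rowP => i.
have [_ _ /inS_idx [n en] _] := par_inS (enum_val i).
have := v0 n; rewrite summxE (bigD1 (enum_val i)) //= big1 => [|t ti].
  by rewrite row_scaleE (slice_row'_dual _ en) eqxx mulr1 addr0 /coefs enum_valK => ->; rewrite !mxE.
by rewrite mxE (slice_row'_dual _ en) eq_sym (negbTE ti) mulr0.
Qed.

(** * Combinations of slice rows and their images *)

Section Vectors.
Variable v : 'rV[rat]_#|{: par}|.
Let c := coefs v.
Notation F := (form (cst 3) c).
Notation u := (v *m slice_mx).

Lemma cf_sum (n : 'I_(dS N 3)) (q : par -> mpoly 3) :
  cf n (\sum_t cst 3 (c t) * q t) = \sum_t c t * cf n (q t).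
Proof. by rewrite raddf_sum; apply: eq_bigr => t _; rewrite /= cfZ. Qed.

Lemma sum_rowM (w : par -> 'rV[rat]_(dS N 3)) (A : 'M_(dS N 3)) n :
  ((\sum_t c t *: w t) *m A) 0 n = \sum_t c t * (w t *m A) 0 n.
Proof.
by rewrite mulmx_suml summxE; apply: eq_bigr => t _; rewrite -scalemxAl mxE.
Qed.

Lemma slice_mx_coef n : u 0 n = cf n (F x0 x1 x2).
Proof.
rewrite mul_slice_mx summxE cf_sum; apply: eq_bigr => t _.
by rewrite mxE slice_row_coef.
Qed.

Lemma slice_mx_E n : (u *m Emx N 3) 0 n = cf n (Phi x0 x1 x2 F).
Proof.
rewrite mul_slice_mx sum_rowM Phi_sum cf_sum; apply: eq_bigr => t _.
by rewrite slice_row_E.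
Qed.

Lemma slice_mx_E2 n : (u *m Ejmx N 3 2) 0 n = cf n (Psi x0 x1 x2 F).
Proof.
rewrite mul_slice_mx sum_rowM Psi_sum cf_sum; apply: eq_bigr => t _.
by rewrite slice_row_E2.
Qed.

Lemma slice_mx'_E2 n : (v *m slice_mx' *m Ejmx N 3 2) 0 n =
  cf n (Psi x0 x1 x2 (fun a b d => F b d a)).
Proof.
rewrite mul_slice_mx' sum_rowM Psi_sum cf_sum; apply: eq_bigr => t _.
by rewrite slice_row'_E2.
Qed.

Lemma averages_Psi_form : averages N (fun a b d => Psi a b d F).
Proof.
apply: (averages_eq _ (@averages_sum N _ _ c (fun t a b d => Psi a b d (slice t)) averages_Psi_slice)).
by move=> a b d; rewrite -Psi_sum.
Qed.

Hypothesis v_rel : v *m rel_mx = 0.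

Let F3 a b z : F a b z + F b (a - b) z + F (a - b) a z = 0.
Proof. exact: form3 (rel_mxP v_rel) _ _ _. Qed.

Lemma slice_mx'_E2_eq0 : v *m slice_mx' *m Ejmx N 3 2 = 0.
Proof.
apply/rowP => n; rewrite slice_mx'_E2 mxE Psi_rot ?raddf0 //.
- exact: formC.
- exact: formNl.
Qed.

Lemma slice_mx_F : u *m Fmx N 3 = - (u *m Ejmx N 3 2).
Proof.
apply/rowP => n; rewrite mulmxBr mulmx1 row_subE slice_mx_E slice_mx_coef [RHS]mxE slice_mx_E2.
rewrite -raddfB -raddfN; congr cf; apply: Phi_Psi => //; [exact: formC|exact: formNl].
Qed.

Lemma slice_mx_E2_E : u *m Ejmx N 3 2 *m Emx N 3 = 0.
Proof.
apply/rowP => n; rewrite mxE.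
under eq_bigr => m _ do rewrite slice_mx_E2.
(* The product of the truncated row with E becomes a coefficient of [Phi] on the averaged
   polynomial. *)
rewrite averages_Psi_form mxE.
pose sg := scale 3 flip1.
apply: (Phi_Av_Psi _ _ _ _ (sg := sg)).
- exact: formC.
- exact: formNl.
- exact: formNz.
- exact: F3.
- exact: cf_flip.
- by move=> p; exact: cfZ.
- by apply: form_rmorph => k; apply: scale_cst.
- by rewrite /sg scale_var rmorph1 mul1r.
- by rewrite /sg scale_var rmorphN1 mulN1r.
- by rewrite /sg scale_var rmorph1 mul1r.
Qed.

Lemma Pev_slice_mx zs : Pev N 3 u zs = F (zs 0%N) (zs 1%N) (zs 2%N).
Proof.
transitivity (\sum_t cst 3 (c t) * Pev N 3 (slice_row t) zs).
  rewrite /Pev; under [RHS]eq_bigr => t _ do rewrite mulr_sumr.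
  rewrite exchange_big; apply: eq_bigr => j _.
  rewrite mul_slice_mx summxE rmorph_sum mulr_suml; apply: eq_bigr => t _.
  by rewrite row_scaleE rmorphM mulrA.
apply: eq_bigr => t _; congr (_ * _).
have [s1 s2 _ _] := par_inS t.
by rewrite PevB !Pev_unit_row // -slice_monf.
Qed.

Lemma slice_mx_inW : inW N 3 u.
Proof.
rewrite /inW !Pev_slice_mx /=; apply: period_rel => //; [exact: formC|exact: formNl].
Qed.

End Vectors.

(** * Independence of the two families and dimension count *)

Let K := kermx rel_mx.

Lemma rel_mx_mul m (D : 'M_(m, _)) : D *m K *m rel_mx = 0.
Proof. by rewrite -mulmxA mulmx_ker mulmx0. Qed.

Hypothesis H : hypH.

Lemma cap_slices : (K *m slice_mx :&: K *m slice_mx')%MS = 0.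
Proof.
apply/eqP/rowV0P => w; rewrite sub_capmx => /andP[/submxP[D Dw] /submxP[D' D'w]].
have w2 : w *m Ejmx N 3 2 = 0.
  by rewrite D'w mulmxA slice_mx'_E2_eq0 // rel_mx_mul.
apply: (H (isT : (2 <= 3)%N)); rewrite Dw mulmxA.
  by apply: slice_mx_inW; rewrite rel_mx_mul.
by rewrite slice_mx_F ?rel_mx_mul // -(mulmxA D) -Dw w2 oppr0.
Qed.

Lemma rank_slices : (2 * \rank K <= dimker N 3)%N.
Proof.
have KC : (K *m slice_mx + K *m slice_mx' <= kermx (Cmx N 3))%MS.
  rewrite addsmx_sub !sub_kermx /Cmx /=; apply/andP; split; apply/eqP/row_matrixP => i.
    rewrite row0 row_mul row_mul mulmxA slice_mx_E2_E //.
    by rewrite -row_mul mulmx_ker row0.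
  rewrite row0 row_mul row_mul mulmxA slice_mx'_E2_eq0 ?mul0mx //.
  by rewrite -row_mul mulmx_ker row0.
(* As C is square, its left and right kernels have the same dimension. *)
rewrite /dimker mxrank_ker mxrank_tr -mxrank_ker.
apply: leq_trans (mxrankS KC); rewrite mxrank_disjoint_sum ?cap_slices //.
by rewrite (mxrankMfree _ slice_mx_free) (mxrankMfree _ slice_mx'_free) mul2n addnn.
Qed.

(** Rank-nullity: the rank of [rel_mx] is at most its number of columns, that is, of conditions. *)
Lemma rank_rel : (\sum_(n < N.+1) indep N n <= \rank K + \sum_(n < N.+1) rels N n)%N.
Proof.
have card_sum (f : 'I_N.+1 -> nat) : #|{: {n : 'I_N.+1 & 'I_(f n)}}| = (\sum_n f n)%N.
  rewrite card_tagged sumnE big_map big_enum; apply: eq_bigr => n _; exact: card_ord.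
rewrite -!card_sum /K mxrank_ker addnC -leq_subLR.
exact/leq_sub2l/rank_leq_col.
Qed.

End Families.

Unset Implicit Arguments.

Theorem theorem1p1 :
  hypH ->
  forall N : nat, (0 < N)%N ->
    2 * smul Oser Sser N <= (dimker N 3)%:R.
Proof.
move=> H N _; have := rank_slices N H; rewrite -(ler_nat rat).
apply: le_trans; rewrite natrM ler_pM2l ?ltr0n //.
have := OS_le N; have := rank_rel N; rewrite -(ler_nat rat) natrD.
lra.
Qed.
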